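(* Let $X$ be a non-empty set equipped with the discrete topology. The Stone-Čech compactification $\beta X$ of $X$ is totally disconnected. Moreover, $\beta X$ is homeomorphic to each of the following Stone's spaces: (1) $\mathcal{U}(\mathcal{P}(X))$; (2) $\mathrm{Hom}(\mathcal{P}(X),\mathbb{Z}_2)$; (3) $\mathrm{Spec}(R_{\mathcal{P}(X)})$, where $(R_{\mathcal{P}(X)},+,\cdot)$ is the ring with $R_{\mathcal{P}(X)}=\mathcal{P}(X)$ and, for all $A,B\in\mathcal{P}(X)$, $A+B:=A\Delta B=(A\setminus B)\cup(B\setminus A)$ and $A\cdot B:=A\cap B$.
   Context: A Stone's space is a compact Hausdorff totally disconnected space. A compactification of $X$ is a compact Hausdorff space $Y$ containing a dense subset homeomorphic to $X$. A compactification $Y$ of $X$ with a dense embedding $\alpha:X\to Y$ is the Stone-Čech compactification $\beta X$ if for every compact Hausdorff space $K$, every continuous map $f:\alpha(X)\to K$ admits a continuous extension $Y\to K$. $\mathcal{P}(X)$ is the power set Boolean algebra (join $\cup$, meet $\cap$, complement $X\setminus A$). $\mathcal{U}(\mathcal{P}(X))$ is the set of ultrafilters of $\mathcal{P}(X)$ with the topology having as a basis the sets $U_A=\{F:A\in F\}$, $A\in\mathcal{P}(X)$. $\mathbb{Z}_2=\{0,1\}$ is the two-element Boolean algebra (so $1+1=1$). For a Boolean algebra $B$, $\mathrm{Hom}(B,\mathbb{Z}_2)$ is the set of Boolean algebra homomorphisms (maps preserving join, meet, $0$, $1$) $B\to\mathbb{Z}_2$, with the subspace topology from the product $\prod_{x\in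 B}\mathbb{Z}_2$, $\mathbb{Z}_2$ discrete. For a commutative ring $R$ with identity, $\mathrm{Spec}(R)$ is the set of prime ideals with the Zariski topology, with basis the sets $V_x=\{P:x\notin P\}$, $x\in R$. *)

(* Defs.v *)
From HB Require Import structures.
From mathcomp Require Import all_boot all_order all_algebra.
From mathcomp Require Import all_classical all_reals all_analysis.

Set Implicit Arguments.
Unset Strict Implicit.
Unset Printing Implicit Defensive.

Import Order.TTheory GRing.Theory.

Local Open Scope classical_set_scope.

Definition homeomorphism (S T : topologicalType) (f : S -> T) :=
  exists g : T -> S,
    [/\ cancel f g, cancel g f, continuous f & continuous g].

Definition homeomorphic (S T : topologicalType) :=
  exists f : S -> T, homeomorphism f.

Definition stone_space (T : topologicalType) :=
  [/\ compact [set: T], hausdorff_space T & totally_disconnected [set: T]].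

Definition corestrict (S T : Type) (f : S -> T) (x : S) : range f :=
  SigSub (mem_set (imageT f x)).

(* The type [range f] carries the subspace topology induced by [T]. *)
Definition embedding (S T : topologicalType) (f : S -> T) :=
  homeomorphism (corestrict f).

Definition compactification (X Y : topologicalType) (alpha : X -> Y) :=
  [/\ compact [set: Y], hausdorff_space Y, dense (range alpha)
    & embedding alpha].

Definition stone_cech (X Y : topologicalType) (alpha : X -> Y) :=
  compactification alpha /\
  forall K : topologicalType, compact [set: K] -> hausdorff_space K ->
  forall f : range alpha -> K, continuous f ->
  exists2 g : Y -> K, continuous g & forall y : range alpha, g (val y) = f y.

(* [UltraFilter] of the library: a filter of subsets of [X] that is maximal
   among the proper ones, i.e. an ultrafilter of the Boolean algebra [set X]. *)
Definition ultrafilters (X : Type) : Type :=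
  [set F : set_system X | UltraFilter F].

Section ultrafilters_topology.
Variable X : Type.

HB.instance Definition _ := Choice.on (ultrafilters X).

Definition ultra_basic (A : set X) : set (ultrafilters X) :=
  [set F | (val F : set_system X) A].

Lemma ultra_basic_cover : \bigcup_(U in range ultra_basic) U = setT.
Proof.
rewrite predeqE => F; split=> // _; exists (ultra_basic setT) => /=.
  by exists setT.
have := valP F; rewrite inE /ultra_basic /= => FU.
exact: (@filterT _ (val F)).
Qed.

Lemma ultra_basic_join (U V : set (ultrafilters X)) F :
  range ultra_basic U -> range ultra_basic V -> U F -> V F ->
  exists W, [/\ range ultra_basic W, W F & W `<=` U `&` V].
Proof.
move=> [A _ <-] [B _ <-] FA FB; exists (ultra_basic (A `&` B)); split.
- by exists (A `&` B).
- have := valP F; rewrite inE /ultra_basic /= => FU; exact: filterI FA FB.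
- move=> G; have := valP G; rewrite inE /ultra_basic /= => GU GAB.
  by split; rewrite /ultra_basic /=; apply: filterS GAB => t [].
Qed.

HB.instance Definition _ := isBaseTopological.Build (ultrafilters X)
  ultra_basic_cover ultra_basic_join.

End ultrafilters_topology.

(* The library's [{tblmorphism B -> B'}] is not used here: it only asks for
   preservation of [\bot] and [\top]. In [bool], join is [||] and meet is [&&].
   As a subset of [{ptws B -> bool}], i.e. of the product of copies of the
   discrete space [bool] indexed by [B], this is a type with the subspace
   topology. *)
Definition boolean_hom d (B : ctbDistrLatticeType d) : set {ptws B -> bool} :=
  [set f | [/\ {morph f : x y / Order.join x y},
               {morph f : x y / Order.meet x y},
               f \bot%O = \bot%O & f \top%O = \top%O]].

Arguments boolean_hom {d} B.

Definition spec (R : comNzRingType) : Type :=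
  [set I : set R | idealr_closed [in I] /\ prime_idealr_closed [in I]].

Section zariski_topology.
Variable R : comNzRingType.
Local Open Scope ring_scope.

HB.instance Definition _ := Choice.on (spec R).

Definition zariski_basic (x : R) : set (spec R) := [set P | ~ (val P : set R) x].

Lemma zariski_basic_cover : \bigcup_(U in range zariski_basic) U = setT.
Proof.
rewrite predeqE => P; split=> // _; exists (zariski_basic 1); first by exists 1.
have := valP P; rewrite inE => -[[_ P1 _] _] P1'.
by move: P1; rewrite notin_setE; apply.
Qed.

Lemma zariski_basic_join (U V : set (spec R)) P :
  range zariski_basic U -> range zariski_basic V -> U P -> V P ->
  exists W, [/\ range zariski_basic W, W P & W `<=` U `&` V].
Proof.
move=> [x _ <-] [y _ <-] Px Py; exists (zariski_basic (x * y)); split.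
- by exists (x * y).
- have := valP P; rewrite inE => -[_ primeP] Pxy.
  have /orP[] : (x \in [in val P]) || (y \in [in val P]).
    by apply: primeP; exact/mem_set.
  + by move/set_mem.
  + by move/set_mem.
- move=> Q; have := valP Q; rewrite inE => -[idQ _] Qxy.
  have [_ absQ] := idealr_closed_nontrivial idQ.
  by split=> Q'; apply: Qxy; apply: set_mem; [rewrite mulrC|];
    apply: absQ; exact/mem_set.
Qed.

HB.instance Definition _ := isBaseTopological.Build (spec R)
  zariski_basic_cover zariski_basic_join.

End zariski_topology.

Definition powerset_ring (X : Type) : Type := set X.

Section powerset_ring.
Variable X : Type.
Implicit Types A B C : powerset_ring X.

HB.instance Definition _ := Choice.on (powerset_ring X).

Definition powerset_add A B : powerset_ring X := (A `\` B) `|` (B `\` A).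
Definition powerset_mul A B : powerset_ring X := A `&` B.

Lemma powerset_addE A B : powerset_add A B = A `+` B. Proof. by []. Qed.

Lemma powerset_addA : associative powerset_add.
Proof. by move=> A B C; rewrite !powerset_addE setYA. Qed.

Lemma powerset_addC : commutative powerset_add.
Proof. by move=> A B; rewrite !powerset_addE setYC. Qed.

Lemma powerset_add0 : left_id (set0 : powerset_ring X) powerset_add.
Proof. by move=> A; rewrite powerset_addE set0Y. Qed.

Lemma powerset_addN : left_inverse (set0 : powerset_ring X) id powerset_add.
Proof. by move=> A; rewrite powerset_addE setYK. Qed.

HB.instance Definition _ := GRing.isZmodule.Build (powerset_ring X)
  powerset_addA powerset_addC powerset_add0 powerset_addN.

Lemma powerset_mulA : associative powerset_mul.
Proof. exact: setIA. Qed.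

Lemma powerset_mulC : commutative powerset_mul.
Proof. exact: setIC. Qed.

Lemma powerset_mul1 : left_id (setT : powerset_ring X) powerset_mul.
Proof. exact: setTI. Qed.

Lemma powerset_mulDl : left_distributive powerset_mul powerset_add.
Proof. by move=> A B C; rewrite !powerset_addE; exact: setIYl. Qed.

HB.instance Definition _ := GRing.Zmodule_isComPzRing.Build (powerset_ring X)
  powerset_mulA powerset_mulC powerset_mul1 powerset_mulDl.

End powerset_ring.

Lemma powerset_ring_oner_neq0 (X : pointedType) :
  (1%R : powerset_ring X) != 0%R.
Proof. by apply/eqP => T0; have : [set: X] point by []; rewrite [setT]T0. Qed.

HB.instance Definition _ (X : pointedType) :=
  GRing.PzSemiRing_isNonZero.Build (powerset_ring X)
    (powerset_ring_oner_neq0 X).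

(* Main.v *)
Require Import Defs.
From mathcomp Require Import all_boot all_order all_algebra.
From mathcomp Require Import all_classical all_reals all_analysis.

(** Every description of the Stone-Cech compactification of a discrete space X
    is compared with the space of ultrafilters of subsets of X.

    That space is compact: an ultrafilter Phi on it converges to the ultrafilter
    of the sets A whose basic open set belongs to Phi ([ultra_compact]). It is
    separated by clopen sets, because the complement of the basic open set of A
    is the basic open set of the complement of A ([ultra_zero_dimensional]).
    Compactness together with separation by clopen sets yields a Stone space,
    and both properties are invariant under homeomorphism.

    Sending a point to its principal ultrafilter embeds X with dense image. A
    map f from X to a compact Hausdorff space K extends by sending an
    ultrafilter u to the limit of the image of u under f; regularity of K makes
    the extension continuous ([ultra_extension]). Hence the ultrafilters form a
    Stone-Cech compactification, and any other one is homeomorphic to it, since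
    the two extensions of the embeddings are mutually inverse on dense subsets
    ([stone_cech_unique]).

    Finally, an ultrafilter is the same thing as its indicator function, which
    is a Boolean homomorphism, and the same thing as its complement, which is a
    prime ideal of the ring of subsets. Both correspondences rest on the fact
    that a family of sets is an ultrafilter as soon as membership commutes with
    intersections and complements ([ultraFilterP]). They turn the basic open set
    of A into the set of homomorphisms sending A to 1, respectively of prime
    ideals omitting A, which makes them homeomorphisms. *)

Set Implicit Arguments.
Unset Strict Implicit.
Unset Printing Implicit Defensive.

Local Open Scope classical_set_scope.

(** * Homeomorphisms and spaces separated by clopen sets *)

Lemma homeomorphic_sym (S T : topologicalType) :
  homeomorphic S T -> homeomorphic T S.
Proof. by move=> [f [g [fK gK cf cg]]]; exists g, f. Qed.

Lemma homeomorphic_trans (S T U : topologicalType) :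
  homeomorphic S T -> homeomorphic T U -> homeomorphic S U.
Proof.
move=> [f [g [fK gK cf cg]]] [h [k [hK kK ch ck]]].
exists (h \o f), (g \o k); split; [exact: can_comp|exact: can_comp| |].
- by move=> x; apply: continuous_comp; [exact: cf|exact: ch].
- by move=> x; apply: continuous_comp; [exact: ck|exact: cg].
Qed.

Lemma homeomorphic_compact (S T : topologicalType) :
  homeomorphic S T -> compact [set: S] -> compact [set: T].
Proof.
move=> [f [g [_ gK cf _]]] cS.
have <- : f @` [set: S] = [set: T].
  by apply/seteqP; split=> // y _; exists (g y); rewrite ?gK.
by apply: continuous_compact => //; exact: continuous_subspaceT.
Qed.

Lemma zero_dimensional_inj (S T : topologicalType) (f : S -> T) :
  injective f -> continuous f -> zero_dimensional T -> zero_dimensional S.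
Proof.
move=> finj cf zT x y xy.
have [|U [cU Ux Uy]] := zT (f x) (f y); first by apply: contra_neq xy => /finj.
by exists (f @^-1` U); split=> //; exact: preimage_clopen.
Qed.

Lemma zero_dimensional_hausdorff (T : topologicalType) :
  zero_dimensional T -> hausdorff_space T.
Proof.
move=> zT; rewrite open_hausdorff => x y xy.
have [U [[oU cU] Ux Uy]] := zT _ _ xy.
exists (U, ~` U); first by rewrite !inE.
by split=> //=; [exact: closed_openC|rewrite setICr].
Qed.

Lemma compact_zero_dimensional_stone (T : topologicalType) :
  compact [set: T] -> zero_dimensional T -> stone_space T.
Proof.
move=> cT zT; split=> //; first exact: zero_dimensional_hausdorff.
exact: zero_dimension_totally_disconnected.
Qed.

Lemma homeomorphic_zero_dimensional (S T : topologicalType) :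
  homeomorphic S T -> zero_dimensional S -> zero_dimensional T.
Proof.
move=> [f [g [_ gK _ cg]]]; apply: zero_dimensional_inj cg.
exact: can_inj gK.
Qed.

(** * Uniqueness of the Stone-Cech compactification *)

(** If f and g differed at x, disjoint neighbourhoods of f x and g x would pull
    back to an open set around x on which they differ everywhere, and such an
    open set meets D. *)
Lemma dense_eq (S T : topologicalType) (D : set S) (f g : S -> T) :
  hausdorff_space T -> dense D -> continuous f -> continuous g ->
  {in D, f =1 g} -> f =1 g.
Proof.
move=> hT dD cf cg fg x; apply/eqP; apply: contrapT => /negP.
move: hT; rewrite open_hausdorff => /[apply].
move=> -[[U V] /= [Ux Vx] [oU oV /eqP UV]].
rewrite !inE in Ux Vx.
have oW : open ((f @^-1` U) `&` (g @^-1` V)).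
  by apply: openI;
    [exact: (continuousP _).1 cf _ oU|exact: (continuousP _).1 cg _ oV].
have [y [[Uy Vy] Dy]] := dD _ (ex_intro _ x (conj Ux Vx)) oW.
have : (U `&` V) (f y) by split=> //=; rewrite fg ?inE.
by rewrite UV.
Qed.

Lemma embedding_continuous (X Y : topologicalType) (alpha : X -> Y) :
  embedding alpha -> continuous alpha.
Proof.
move=> [_ [_ _ ca _]] x.
have cval := @initial_continuous (range alpha) Y val.
exact: (@continuous_comp _ _ _ (corestrict alpha) val x (ca x) (cval _)).
Qed.

(** The extension property is stated for maps on the image of alpha; composing
    with the inverse of the embedding makes it apply to maps on X itself. *)
Lemma stone_cech_extend (X Y K : topologicalType) (alpha : X -> Y)
    (f : X -> K) :
  stone_cech alpha -> compact [set: K] -> hausdorff_space K -> continuous f ->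
  exists2 g : Y -> K, continuous g & g \o alpha =1 f.
Proof.
move=> [[_ _ _ [beta [alphaK _ _ cbeta]]] ext] cK hK cf.
have [|g cg gE] := ext K cK hK (f \o beta).
  by move=> y; apply: continuous_comp; [exact: cbeta|exact: cf].
by exists g => // x; have := gE (corestrict alpha x); rewrite /= alphaK.
Qed.

(** Each embedding extends along the other; both composites fix a dense set
    pointwise, so they are identities. *)
Lemma stone_cech_unique (X Y Z : topologicalType) (alpha : X -> Y)
    (beta : X -> Z) :
  stone_cech alpha -> stone_cech beta -> homeomorphic Y Z.
Proof.
move=> sa sb; have [[cY hY dY ea] _] := sa; have [[cZ hZ dZ eb] _] := sb.
have [f cf fE] := stone_cech_extend sa cZ hZ (embedding_continuous eb).
have [g cg gE] := stone_cech_extend sb cY hY (embedding_continuous ea).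
exists f, g; split=> //.
- apply: (@dense_eq _ _ _ (g \o f) id hY dY) => //.
    by move=> y; apply: continuous_comp; [exact: cf|exact: cg].
    by move=> y U.
  by move=> y; rewrite inE => -[x _ <-]; rewrite /= [f _]fE [g _]gE.
- apply: (@dense_eq _ _ _ (f \o g) id hZ dZ) => //.
    by move=> z; apply: continuous_comp; [exact: cg|exact: cf].
    by move=> z U.
  by move=> z; rewrite inE => -[x _ <-]; rewrite /= [g _]gE [f _]fE.
Qed.

(** * Ultrafilters as set families commuting with the Boolean operations *)

(** In place of properness, upward closure and maximality, two equivalences
    suffice: that F contains the full set follows, since otherwise F would
    contain the empty set, hence every superset of it. *)
Lemma ultraFilterP (T : Type) (F : set_system T) :
  UltraFilter F <->
  (forall A B, F (A `&` B) <-> F A /\ F B) /\ (forall A, F (~` A) <-> ~ F A).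
Proof.
split=> [FU|[FI FC]].
  split=> [A B|A].
    split=> [FAB|[FA FB]]; last exact: filterI.
    by split; apply: filterS FAB => x [].
  split=> [FnA FA|nFA]; last by have [] := in_ultra_setVsetC A FU.
  by have /filter_ex[x []] : F (A `&` ~` A) by exact: filterI.
have FT : F setT.
  apply: contrapT => nFT; have F0 := (FC _).2 nFT.
  by have /FI[] : F (~` setT `&` setT) by rewrite setIT.
have FF : ProperFilter F.
  split; first by rewrite -setCT => /FC.
  split=> // [A B FA FB|A B AB FA]; first by apply/FI.
  by move: FA; rewrite -(setIidl AB) => /FI[].
split=> // G GF FG; apply/seteqP; split=> // A GA.
apply: contrapT => /FC /FG GnA.
by have /filter_ex[x []] : G (A `&` ~` A) by exact: filterI.
Qed.

(** * The space of ultrafilters is compact and separated by clopen sets *)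

Section ultrafilters_theory.
Variable X : Type.
Implicit Types (u v : ultrafilters X) (A B : set X).

Definition mk_ultra (F : set_system X) (FU : UltraFilter F) : ultrafilters X :=
  SigSub (mem_set FU).

Lemma ultrafilters_ultra u : UltraFilter (val u).
Proof. exact: set_valP. Qed.

Lemma ultraI u A B : val u (A `&` B) <-> val u A /\ val u B.
Proof. by have /ultraFilterP[] := ultrafilters_ultra u. Qed.

Lemma ultraC u A : val u (~` A) <-> ~ val u A.
Proof. by have /ultraFilterP[] := ultrafilters_ultra u. Qed.

Lemma ultraU u A B : val u (A `|` B) <-> val u A \/ val u B.
Proof.
rewrite -[A `|` B]setCK setCU ultraC ultraI !ultraC.
by split=> [/not_andP[]/contrapT|]; [left|right|case=> ? []].
Qed.

(** By maximality, inclusion of ultrafilters already forces equality. *)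
Lemma ultrafiltersP u v : (forall A, val u A -> val v A) -> u = v.
Proof.
have [_ umax] := ultrafilters_ultra u; have vU := ultrafilters_ultra v.
by move=> uv; apply: val_inj; rewrite (umax (val v)).
Qed.

Lemma open_ultra_basic A : open (ultra_basic A).
Proof.
exists [set ultra_basic A]; first by move=> _ ->; exists A.
by rewrite bigcup_set1.
Qed.

Lemma nbhs_ultra u (U : set (ultrafilters X)) :
  nbhs u U <-> exists2 A, val u A & ultra_basic A `<=` U.
Proof.
split=> [|[A uA AU]]; rewrite nbhsE.
  move=> [_ [[D' D'D <-] [V D'V Vu]] VU].
  have [A _ AV] := D'D _ D'V; exists A; first by rewrite -AV in Vu.
  by rewrite AV => v Vv; apply: VU; exists V.
by exists (ultra_basic A) => //; split=> //; exact: open_ultra_basic.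
Qed.

Lemma continuous_to_ultra (T : topologicalType) (f : T -> ultrafilters X) :
  (forall A, open (f @^-1` ultra_basic A)) -> continuous f.
Proof.
move=> fo t U /nbhs_ultra[A ftA AU].
apply: (@filterS _ _ _ (f @^-1` ultra_basic A)); first by move=> s /AU.
by apply: open_nbhs_nbhs; split.
Qed.

Lemma ultra_zero_dimensional : zero_dimensional (ultrafilters X).
Proof.
move=> u v uv.
have [A /not_implyP[uA vA]] : exists A, ~ (val u A -> val v A).
  by apply/existsNP => uvA; move/eqP: uv; apply; exact: ultrafiltersP.
exists (ultra_basic A); split=> //; split; first exact: open_ultra_basic.
rewrite -openC; have -> : ~` ultra_basic A = ultra_basic (~` A).
  by apply/seteqP; split=> w; rewrite /ultra_basic /= ultraC.
exact: open_ultra_basic.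
Qed.

(** The limit of an ultrafilter Phi of sets of ultrafilters is the family of the
    sets A whose basic open set is in Phi; it is an ultrafilter because taking
    basic open sets commutes with intersections and complements. *)
Lemma ultra_compact : compact [set: ultrafilters X].
Proof.
rewrite compact_ultra => /= Phi PhiU _.
have [PhiI PhiC] := (ultraFilterP _).1 PhiU.
have FU : UltraFilter [set A : set X | Phi (ultra_basic A)].
  apply/ultraFilterP; split=> [A B|A] /=.
    rewrite -PhiI; suff -> : ultra_basic (A `&` B) =
        ultra_basic A `&` ultra_basic B by [].
    by apply/seteqP; split=> w; rewrite /ultra_basic /= ultraI.
  rewrite -PhiC; suff -> : ultra_basic (~` A) = ~` ultra_basic A by [].
  by apply/seteqP; split=> w; rewrite /ultra_basic /= ultraC.
exists (mk_ultra FU); split=> // U /nbhs_ultra[A FA AU].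
exact: (@filterS _ Phi _ _ _ AU FA).
Qed.

(** * The ultrafilters form a Stone-Cech compactification *)

Definition principal_ultra (x : X) : ultrafilters X :=
  mk_ultra (principal_filter_ultra x).

Lemma principal_ultraP x A : val (principal_ultra x) A <-> A x.
Proof. exact: principal_filterP. Qed.

Lemma principal_ultra_dense : dense (range principal_ultra).
Proof.
move=> O [u Ou] oO.
have /nbhs_ultra[A uA AO] : nbhs u O by exact: open_nbhs_nbhs.
have uU := ultrafilters_ultra u.
have [x Ax] := filter_ex uA.
by exists (principal_ultra x); split;
  [apply: AO; apply/principal_ultraP|exists x].
Qed.

Lemma image_ultra (K : Type) (f : X -> K) u : UltraFilter (f @ val u).
Proof.
apply/ultraFilterP; split=> [A B|A] /=.
  exact: (ultraI u (f @^-1` A)).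
exact: (ultraC u (f @^-1` A)).
Qed.

(** The extension maps u to the limit of the ultrafilter [f @ val u], which
    exists because K is compact. For continuity at u, pick inside a given
    neighbourhood of the limit a closed one, the closure of V: every ultrafilter
    containing the preimage of V has its limit in that closure. *)
Lemma ultra_extension (K : topologicalType) (f : X -> K) :
  compact [set: K] -> hausdorff_space K ->
  exists2 g : ultrafilters X -> K, continuous g & g \o principal_ultra =1 f.
Proof.
move=> cK hK.
have lim_ex u : {y : K | f @ val u --> y}.
  apply: cid; have := cK; rewrite compact_ultra => /(_ _ (image_ultra f u)).
  have uU := ultrafilters_ultra u.
  by case; [exact: (@filterT _ (val u))|move=> y [_ fy]; exists y].
exists (fun u => sval (lim_ex u)) => [u W|x /=].
  have fu : f @ val u --> sval (lim_ex u) := svalP (lim_ex u).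
  move=> /(compact_regular hK cK filterT)[V Vgu VW].
  apply/nbhs_ultra; exists (f @^-1` V); first exact: fu.
  move=> v vV; apply: VW => B Bgv.
  have vU := ultrafilters_ultra v.
  have fv : (f @ val v) B := svalP (lim_ex v) _ Bgv.
  have /filter_ex[x [Vx Bx]] : (f @ val v) (V `&` B) by exact: filterI.
  by exists x.
apply: (@cvg_unique _ hK (f @ val (principal_ultra x))).
- by have := image_ultra f (principal_ultra x); case.
- exact: svalP (lim_ex _).
- by move=> B /nbhs_singleton Bfx; apply/principal_ultraP.
Qed.

End ultrafilters_theory.

Section discrete_case.
Variable X : pdiscreteTopologicalType.

(** The inverse on the image is continuous because the basic open set of a
    singleton contains a single principal ultrafilter. *)
Lemma principal_ultra_embedding : embedding (@principal_ultra X).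
Proof.
have /choice[g gE] (y : range (@principal_ultra X)) :
    exists x, principal_ultra x = val y.
  by have [x _ xy] := set_valP y; exists x.
have pinj : injective (@principal_ultra X).
  move=> x y xy; apply/esym.
  have : val (principal_ultra x) [set x] by apply/principal_ultraP.
  by rewrite xy => /principal_ultraP.
exists g; split.
- by move=> x; apply: pinj; rewrite gE.
- by move=> y; apply: val_inj; rewrite /= gE.
- by apply/continuousP => A _; exact: discrete_open.
- move=> y U /nbhs_singleton Uy.
  have : nbhs (val y) (ultra_basic [set g y]).
    apply/nbhs_ultra; exists [set g y] => //.
    by rewrite -gE; apply/principal_ultraP.
  have cval := @initial_continuous (range (@principal_ultra X)) _ val.
  move=> /cval N; apply: (@filterS _ (nbhs y) _ _ _ _ N) => z.
  by rewrite /= /ultra_basic /= -gE => /principal_ultraP ->.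
Qed.

Lemma principal_ultra_stone_cech : stone_cech (@principal_ultra X).
Proof.
split=> [|K cK hK f cf].
  split; [exact: ultra_compact| |exact: principal_ultra_dense|
    exact: principal_ultra_embedding].
  exact/zero_dimensional_hausdorff/ultra_zero_dimensional.
have [g cg gE] := ultra_extension (f \o corestrict (@principal_ultra X)) cK hK.
exists g => // y; have [x _ xy] := set_valP y.
have -> : y = corestrict (@principal_ultra X) x by exact: val_inj.
exact: gE.
Qed.

End discrete_case.

(** * Ultrafilters and Boolean homomorphisms *)

Lemma continuous_to_prod (T : topologicalType) (I : Type)
    (K : I -> topologicalType) (f : T -> prod_topology K) :
  (forall i, continuous (fun t => f t i)) -> continuous f.
Proof.
move=> fc t; apply/cvg_sup => i.
move=> U [_ [[V oV <-] Vft] VU].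
have : nbhs t ((fun t => f t i) @^-1` V) by apply: fc; exact: open_nbhs_nbhs.
by apply: filterS => s /VU.
Qed.

Section boolean_homs.
Variable X : Type.

Lemma bool_of_ultra_hom (u : ultrafilters X) :
  boolean_hom (set X) (fun A => `[< val u A >]).
Proof.
have uU := ultrafilters_ultra u.
split=> [A B|A B||].
- apply/asboolP/orP; rewrite joinEset.
    by move=> /ultraU[?|?]; [left|right]; exact/asboolP.
  by move=> [/asboolP ?|/asboolP ?]; apply/ultraU; [left|right].
- apply/asboolP/andP; rewrite meetEset.
    by move=> /ultraI[? ?]; split; exact/asboolP.
  by move=> [/asboolP ? /asboolP ?]; exact/ultraI.
- by apply/asboolPn; rewrite botEset; exact: filter_not_empty.
- by apply/asboolP; rewrite topEset; exact: filterT.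
Qed.

Lemma ultra_of_hom (f : set X -> bool) :
  boolean_hom (set X) f -> UltraFilter [set A | f A].
Proof.
move=> [fU fI f0 f1]; apply/ultraFilterP; split=> [A B|A] /=.
  by rewrite -meetEset fI; split=> /andP.
have := fI A (~` A); have := fU A (~` A).
rewrite meetEset joinEset setUCr setICr -topEset -botEset f0 f1.
by case: (f A); case: (f (~` A)).
Qed.

(** The indicator at A is locally constant: it is 1 on the basic open set of A
    and 0 on that of the complement of A. *)
Lemma ultra_homeomorphic_hom :
  homeomorphic (ultrafilters X) (boolean_hom (set X)).
Proof.
pose to u : boolean_hom (set X) := SigSub (mem_set (bool_of_ultra_hom u)).
pose from (f : boolean_hom (set X)) := mk_ultra (ultra_of_hom (set_valP f)).
exists to, from; split.
- by move=> u; apply: ultrafiltersP => A /asboolP.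
- by move=> f; apply: val_inj; apply/funext => A /=; apply: asboolb.
- apply: continuous_comp_initial; apply: continuous_to_prod => A u U.
  move=> /nbhs_singleton Uto; apply/nbhs_ultra.
  have {Uto}Uu : U `[< val u A >] by exact: Uto.
  have [uA|uA] := pselect (val u A).
    exists A => // v vA; change (U `[< val v A >]).
    by rewrite (asboolT vA); rewrite (asboolT uA) in Uu.
  exists (~` A); first exact/ultraC.
  move=> v /ultraC vA; change (U `[< val v A >]).
  by rewrite (asboolF vA); rewrite (asboolF uA) in Uu.
- apply: continuous_to_ultra => A.
  have cA : continuous
      (fun f : boolean_hom (set X) => proj A (val f)).
    move=> f.
    have cval := @initial_continuous (boolean_hom (set X)) _ val.
    by apply: (continuous_comp (cval f)); exact: proj_continuous.
  exact: (continuousP _).1 cA [set true] (discrete_open _).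
Qed.

End boolean_homs.

(** * Ultrafilters and prime ideals *)

Section zariski_theory.
Variable R : comNzRingType.

Lemma open_zariski_basic (x : R) : open (zariski_basic x).
Proof.
exists [set zariski_basic x]; first by move=> _ ->; exists x.
by rewrite bigcup_set1.
Qed.

Lemma continuous_to_spec (T : topologicalType) (f : T -> spec R) :
  (forall x, open (f @^-1` zariski_basic x)) -> continuous f.
Proof.
move=> fo; apply/continuousP => _ [D' D'D <-].
rewrite preimage_bigcup; apply: bigcup_open => V D'V.
by have [x _ <-] := D'D _ D'V; exact: fo.
Qed.

End zariski_theory.

Section spectrum.
Local Open Scope ring_scope.
Variable X : pointedType.

(** An ultrafilter contains a union only if it contains one of the two sets,
    which makes its complement additively closed; it is closed under
    intersections, which makes its complement prime. *)
Lemma ultra_compl_prime (u : ultrafilters X) :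
  [set I : set (powerset_ring X) | idealr_closed [in I] /\
     prime_idealr_closed [in I]] [set A | ~ val u A].
Proof.
have uU := ultrafilters_ultra u.
split; [split|].
- by apply/mem_set; exact: filter_not_empty.
- by rewrite notin_setE /=; apply; exact: filterT.
- move=> A B C; rewrite !inE /= => uB uC uABC.
  (* the combination [A * B + C] is a symmetric difference inside [B `|` C] *)
  have /ultraU[|//] : val u (B `|` C).
    by apply: filterS uABC => x [[[_ Bx] _]|[Cx _]]; [left|right].
  exact: uB.
- move=> A B; rewrite !inE /= => uAB; apply/orP.
  have [uA|uA] := pselect (val u A); last by left; apply/mem_set.
  by right; apply/mem_set => uB; apply: uAB; exact/ultraI.
Qed.

(** Since the product of A and its complement is 0 and their sum is 1, a prime
    ideal contains exactly one of the two. *)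
Lemma prime_compl_ultra (P : spec (powerset_ring X)) :
  UltraFilter [set A | ~ (val P : set (powerset_ring X)) A].
Proof.
have [[P0 P1 PD] Pprime] := set_valP P.
have PM A B : val P B -> val P (A `&` B).
  move=> /mem_set PB; apply/set_mem.
  by have := PD A B 0%R PB P0; rewrite GRing.addr0.
apply/ultraFilterP; split=> [A B|A] /=.
  split=> [nPAB|[nPA nPB] PAB].
    split=> [PA|PB]; apply: nPAB; last exact: PM.
    by rewrite setIC; exact: PM.
  by have /orP[/set_mem|/set_mem] := Pprime A B (mem_set PAB).
split=> [nPnA nPA|nnPA PnA].
  have A0 : (A : powerset_ring X) * (~` A : powerset_ring X) = 0.
    exact: setICr.
  have /orP[/set_mem //|/set_mem //] :
      (A \in [in val P]) || (~` A \in [in val P]).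
  by apply: Pprime; rewrite A0.
have A1 : (1 : powerset_ring X) * A + (~` A : powerset_ring X) = 1.
  by rewrite GRing.mul1r; apply/seteqP; split=> // x _;
    have [Ax|nAx] := pselect (A x); [left; split=> // /(_ Ax)|right].
by move: P1; rewrite -A1 PD //; apply/mem_set => //; exact: contrapT.
Qed.

Lemma ultra_homeomorphic_spec :
  homeomorphic (ultrafilters X) (spec (powerset_ring X)).
Proof.
pose to u : spec (powerset_ring X) := SigSub (mem_set (ultra_compl_prime u)).
pose from (P : spec (powerset_ring X)) := mk_ultra (prime_compl_ultra P).
exists to, from; split.
- by move=> u; apply: ultrafiltersP => A /= /contrapT.
- by move=> P; apply: val_inj; apply/seteqP; split=> A /=;
  [move/contrapT|move=> PA nPA; exact: nPA].
- apply: continuous_to_spec => A.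
  rewrite (_ : _ @^-1` _ = ultra_basic A); first exact: open_ultra_basic.
  by apply/seteqP; split=> u; rewrite /zariski_basic /ultra_basic /= notK.
- by apply: continuous_to_ultra => A; exact: open_zariski_basic.
Qed.

End spectrum.

Unset Implicit Arguments.

Theorem corollary6p12 (X : pdiscreteTopologicalType) :
  (exists (Y : topologicalType) (alpha : X -> Y), stone_cech alpha) /\
  forall (betaX : topologicalType) (alpha : X -> betaX), stone_cech alpha ->
  [/\ totally_disconnected [set: betaX],
      stone_space (ultrafilters X) /\ homeomorphic betaX (ultrafilters X),
      stone_space (boolean_hom (set X)) /\
        homeomorphic betaX (boolean_hom (set X))
    & stone_space (spec (powerset_ring X)) /\
        homeomorphic betaX (spec (powerset_ring X))].
Proof.
split; first by exists (ultrafilters X), (@principal_ultra X);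
  exact: principal_ultra_stone_cech.
move=> betaX alpha sa.
have UX : stone_space (ultrafilters X).
  by apply: compact_zero_dimensional_stone; [exact: ultra_compact|
    exact: ultra_zero_dimensional].
have bU := stone_cech_unique sa (principal_ultra_stone_cech X).
have stone T : homeomorphic (ultrafilters X) T -> stone_space T.
  move=> UT; apply: compact_zero_dimensional_stone.
    by apply: homeomorphic_compact UT _; exact: ultra_compact.
  by apply: homeomorphic_zero_dimensional UT _; exact: ultra_zero_dimensional.
split.
- by have [] := stone _ (homeomorphic_sym bU).
- by [].
- have Uh := ultra_homeomorphic_hom X.
  by split; [exact: stone|exact: homeomorphic_trans bU Uh].
- have Us := ultra_homeomorphic_spec X.
  by split; [exact: stone|exact: homeomorphic_trans bU Us].
Qed.
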